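(* Let $(X,d)$ be a finite metric space, $x\in X$, and $r>0$. If the point $x$ is locally crushable at scale $r$ in $X$, then $\mathrm{Rips}(X,r)$ is homotopy equivalent to $\mathrm{Rips}(X\setminus\{x\},r)$.
   Context: For a metric space $(X,d)$ and $r\ge 0$, the (closed) Rips complex $\mathrm{Rips}(X,r)$ is the abstract simplicial complex with vertex set $X$ in which a nonempty finite subset $\sigma\subseteq X$ is a simplex if and only if $\mathrm{Diam}(\sigma)=\max_{x,y\in\sigma} d(x,y)\le r$; homotopy equivalence refers to geometric realizations. For a finite metric space $(X,d)$, $x\in X$ and $r>0$, the point $x$ is locally crushable (at scale $r$) in $X$ if there exists a subset $L_x\subset X$ not containing $x$ and of diameter $\mathrm{Diam}(L_x)\le r$, such that for each $A\subset X$ satisfying $x\in A$ and $\mathrm{Diam}(A)\le r$ there exists $y\in L_x$ with $\mathrm{Diam}(A\cup\{y\})\le r$. (Here $\subset$ allows equality.) *)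

(* Defs.v *)
From HB Require Import structures.
From mathcomp Require Import all_boot all_order all_algebra.
From mathcomp Require Import all_classical all_reals all_analysis.
Import Order.TTheory GRing.Theory Num.Theory.
Import numFieldNormedType.Exports.

Set Implicit Arguments.
Unset Strict Implicit.
Unset Printing Implicit Defensive.

Local Open Scope ring_scope.

#[short(type="finMetricType")]
HB.structure Definition FinMetric (K : numDomainType) :=
  { M of Finite M & Metric K M }.

(* A vertex of the complex is a v such that [set v] is a simplex; elements of V
   that are not vertices are allowed, so that a complex on a subset of V is
   still a [simplicial_complex V]. *)
Record simplicial_complex (V : finType) := SimplicialComplex {
  simplices :> {set {set V}};
  simplex_neq0 : forall s, s \in simplices -> s != finset.set0;
  simplex_face : forall s t, s \in simplices ->
    t != finset.set0 -> t \subset s -> t \in simplices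
}.

(* Points are given by their barycentric coordinates. As V is finite, the
   topology induced by the product topology on V -> R is the weak topology
   determined by the closed simplices. *)
Definition realization_set (R : realType) (V : finType)
    (K : simplicial_complex V) : set {ptws V -> R} :=
  [set p : V -> R | [/\ forall v, 0 <= p v, \sum_v p v = 1
                      & [set v | p v != 0]%SET \in simplices K]]%classic.

Arguments realization_set R {V} K.

Definition realization (R : realType) (V : finType)
  (K : simplicial_complex V) : topologicalType := set_type (realization_set R K).

Section homotopy.
Context (R : realType).
Local Open Scope classical_set_scope.

(* Only the values of H on X x [0, 1] are relevant. *)
Definition homotopic (X Y : topologicalType) (f g : X -> Y) :=
  exists H : X * R -> Y,
    [/\ {within [set: X] `*` `[0, 1], continuous H},
        forall x, H (x, 0) = f x
      & forall x, H (x, 1) = g x].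

Definition homotopy_equivalent (X Y : topologicalType) :=
  exists (f : X -> Y) (g : Y -> X),
    [/\ continuous f, continuous g,
        homotopic (g \o f) idfun
      & homotopic (f \o g) idfun].

End homotopy.

Section rips.
Context (R : realType) (X : finMetricType R).
Implicit Types (A B L s t : {set X}) (x y : X) (r : R).

Definition diam A : R :=
  \big[Num.max/0]_(p : X * X | (p.1 \in A) && (p.2 \in A)) mdist p.1 p.2.

Fact diamS A B : A \subset B -> diam A <= diam B.
Proof.
move=> /fintype.subsetP AB; apply: sub_bigmax => -[x y] /= /andP[xA yA].
by rewrite !AB.
Qed.

Definition rips_simplices A r : {set {set X}} :=
  [set s : {set X} | [&& s != finset.set0, s \subset A & diam s <= r]]%SET.

Fact rips_simplex_neq0 A r s : s \in rips_simplices A r -> s != finset.set0.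
Proof. by rewrite inE => /andP[]. Qed.

Fact rips_simplex_face A r s t : s \in rips_simplices A r ->
  t != finset.set0 -> t \subset s -> t \in rips_simplices A r.
Proof.
rewrite !inE => /and3P[_ sA sr] -> ts /=.
by rewrite (fintype.subset_trans ts sA) (le_trans (diamS ts)).
Qed.

(* The Rips complex of the subspace A of X. *)
Definition rips A r : simplicial_complex X :=
  SimplicialComplex (@rips_simplex_neq0 A r) (@rips_simplex_face A r).

Definition locally_crushable x r :=
  exists L, [/\ x \notin L, diam L <= r &
    forall A, x \in A -> diam A <= r ->
      exists2 y, y \in L & diam (A :|: [set y])%SET <= r].

End rips.

(* Main.v *)
Require Import Defs.
From mathcomp Require Import all_boot all_order all_algebra.
From mathcomp Require Import all_classical all_reals all_analysis.
Import Order.TTheory GRing.Theory Num.Theory.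
Import numFieldNormedType.Exports.

(** One explicit formula both retracts Rips(X, r) onto Rips(X \ x, r) and
    deforms the identity into this retraction.

    Let p be a point of the realization, in barycentric coordinates, and let
    0 <= e <= p x be a threshold. Cut the amount e off every coordinate,
    truncating at 0, and give each y of the crushing set L the new mass
    max(e - far p y, 0), where far p y is the mass that p puts on the points at
    distance more than r from y; then normalize. A vertex v survives the cut
    only if e < p v, and y receives mass only if far p y < e. Both together
    force d(v, y) <= r, since otherwise p v <= far p y < e < p v. Moreover the
    surviving vertices lie in the simplex carrying p, and L has diameter at most
    r. A Rips complex is determined by its edges, so the new support is again a
    simplex ([crush_realization]).

    Normalization needs a positive total mass. If e = 0 nothing changes and the
    total is 1. If e > 0, then p x > 0, so the carrier of p contains x, and local
    crushability gives some y in L that is within r of the whole carrier. For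
    this y, far p y = 0 and y receives the mass e ([crush_mass_sum_gt0]).

    At e = p x the vertex x loses all its mass, so the result lies over
    X \ x; if p x = 0 the point p does not move. Hence e = p x defines a
    retraction, and e = (1 - s) * p x, for s running over [0, 1], is a homotopy
    from it to the identity. Every ingredient is a continuous function of the
    finitely many coordinates of p. *)

Local Open Scope ring_scope.

Section realization_topology.
Context {R : realType} {V : finType}.
Implicit Types K : simplicial_complex V.

Lemma continuous_coord K (v : V) :
  continuous (fun p : realization R K => val p v : R).
Proof.
move=> p.
apply: (@continuous_comp (realization R K) {ptws V -> R} R val (fun q => q v)).
  exact: initial_continuous.
exact: proj_continuous.
Qed.

(** The realization carries the initial topology of its inclusion into a
    product, so continuity into it can be tested on coordinates. *)
Lemma continuous_to_realization K (T : topologicalType)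
    (f : T -> realization R K) :
  (forall v, continuous (fun t => val (f t) v : R)) -> continuous f.
Proof.
move=> fc; apply: continuous_comp_initial => t.
apply/cvg_sup => v.
exact: (@continuous_comp_initial _ _ _ (fun q : V -> R => q v) _ (fc v)).
Qed.

End realization_topology.

Section rips_faces.
Context {R : realType} {X : finMetricType R}.
Implicit Types (A s : {set X}) (r : R) (p : X -> R).

Lemma diam_leP A r : 0 <= r ->
  reflect {in A &, forall u v, mdist u v <= r} (diam A <= r).
Proof.
move=> r0; apply: (iffP (bigmax_leP _ _ _ _)) => [[_ H] u v uA vA|H].
  by apply: (H (u, v)); rewrite /= uA vA.
by split=> // -[u v] /= /andP[]; exact: H.
Qed.

(** Membership only involves pairs of vertices of the support: this is the flag
    property of Rips complexes. *)
Lemma rips_realizationP A r p : 0 <= r ->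
  realization_set R (rips A r) p <->
  [/\ forall v, 0 <= p v, \sum_v p v = 1,
      forall v, p v != 0 -> v \in A
    & forall u v, p u != 0 -> p v != 0 -> mdist u v <= r].
Proof.
move=> r0; split=> [[p0 p1]|[p0 p1 pA pr]].
  rewrite inE => /and3P[_ /fintype.subsetP sA /(diam_leP _ _ r0) sr].
  split=> // [v vp|u v up vp]; first by apply: sA; rewrite inE.
  by apply: sr; rewrite inE.
split=> //; rewrite inE; apply/and3P; split.
(* A point of empty support would have total mass 0. *)
- apply/negP => /eqP /setP s0; move: p1; rewrite big1; last first.
    by move=> v _; move: (s0 v); rewrite !inE => /negbFE/eqP.
  by move/esym/eqP; rewrite oner_eq0.
- by apply/fintype.subsetP => v; rewrite inE; exact: pA.
- by apply/diam_leP => // u v; rewrite !inE; exact: pr.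
Qed.

Lemma rips_realization_D1 (x : X) r p : 0 <= r ->
  realization_set R (rips ([set: X] :\ x)%SET r) p <->
  realization_set R (rips [set: X]%SET r) p /\ p x = 0.
Proof.
move=> r0; split.
  case/(rips_realizationP _ _ _ r0) => p0 p1 pA pr; split.
    by apply/rips_realizationP.
  by apply/eqP; apply: contraT => /pA; rewrite !inE eqxx.
case=> /(rips_realizationP _ _ _ r0)[p0 p1 _ pr] px.
apply/rips_realizationP => //; split=> // v pv.
by rewrite !inE andbT; apply: contraNneq pv => ->; rewrite px.
Qed.

End rips_faces.

Section crushing.
Context {R : realType} {X : finMetricType R}.
Variables (x : X) (r : R) (L : {set X}).
Implicit Types (e : R) (p : X -> R).

Definition far p (y : X) : R := \sum_(v | r < mdist v y) p v.

(** In the first summand the threshold is cut off the coordinates, so that small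
    coordinates vanish; in the second, vertices of L receive mass only when they
    are adjacent to all the large coordinates. As e tends to 0 the new mass
    vanishes too, which is what makes the construction continuous along the
    subcomplex where p x = 0. *)
Definition crush_mass e p (v : X) : R :=
  Num.max (p v - e) 0 + (if v \in L then Num.max (e - far p v) 0 else 0).

Definition crush e p (v : X) : R := crush_mass e p v / \sum_u crush_mass e p u.

Lemma crush_mass_ge0 e p v : 0 <= crush_mass e p v.
Proof.
by rewrite addr_ge0 ?le_max ?lexx ?orbT//; case: ifP; rewrite ?le_max ?lexx ?orbT.
Qed.

Lemma crush_mass_supp e p v : crush_mass e p v != 0 ->
  e < p v \/ (v \in L /\ far p v < e).
Proof.
rewrite /crush_mass; case: (ltP e (p v)) => [|ep]; first by left.
rewrite max_r ?subr_le0// add0r; case: ifP => [vL|]; last by rewrite eqxx.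
case: (ltP (far p v) e) => [|fe]; first by right.
by rewrite max_r ?subr_le0// eqxx.
Qed.

Lemma far_ge p y v : (forall u, 0 <= p u) -> r < mdist v y -> p v <= far p y.
Proof. by move=> p0 vy; rewrite /far (bigD1 v)//= lerDl sumr_ge0. Qed.

(** A vertex that survives the cut is adjacent to any y that receives mass: if
    it were far from y, its coordinate alone would push far p y above e. *)
Lemma far_lt e p y v : (forall u, 0 <= p u) ->
  far p y < e -> e < p v -> mdist v y <= r.
Proof.
move=> p0 fe ep; rewrite leNgt; apply/negP => /(far_ge _ _ _ p0) pf.
by move: (lt_trans (le_lt_trans pf fe) ep); rewrite ltxx.
Qed.

Lemma crush_mass0 p : (forall u, 0 <= p u) -> crush_mass 0 p =1 p.
Proof.
move=> p0 v; rewrite /crush_mass subr0 max_l// sub0r max_r.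
  by case: ifP; rewrite addr0.
by rewrite oppr_le0 sumr_ge0.
Qed.

Lemma crush0 p : realization_set R (rips [set: X]%SET r) p -> crush 0 p = p.
Proof.
case=> p0 p1 _; apply/funext => v; rewrite /crush crush_mass0//.
by under eq_bigr do rewrite crush_mass0//; rewrite p1 divr1.
Qed.

Hypothesis r0 : 0 <= r.
Hypothesis xL : x \notin L.
Hypothesis Lr : diam L <= r.
Hypothesis Lx : forall A : {set X}, x \in A -> diam A <= r ->
  exists2 y, y \in L & diam (A :|: [set y])%SET <= r.

(** When e > 0 the cut may remove all of p. Local crushability, applied to the
    carrier of p, then provides a y in L with far p y = 0, which receives the
    mass e. *)
Lemma crush_mass_sum_gt0 e p : realization_set R (rips [set: X]%SET r) p ->
  0 <= e <= p x -> 0 < \sum_v crush_mass e p v.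
Proof.
move=> Kp /andP[e0 ex]; have [p0 p1 _ pr] := (rips_realizationP _ _ _ r0).1 Kp.
move: e0; rewrite le_eqVlt => /predU1P[<-|e0].
  by under eq_bigr do rewrite crush_mass0//; rewrite p1.
(* The carrier of p; it contains x because 0 < e <= p x. *)
pose A := [set v | p v != 0]%SET.
have [|| y yL /(diam_leP _ _ r0) Ay] := Lx A.
- by rewrite inE; apply: lt0r_neq0; exact: lt_le_trans ex.
- by apply/diam_leP => // u v; rewrite !inE; exact: pr.
have fy : far p y = 0.
  rewrite /far big1// => v; apply: contraTeq => pv; rewrite -leNgt.
  by apply: Ay; rewrite !inE ?pv ?eqxx ?orbT.
rewrite (bigD1 y)//=; apply: ltr_pwDl; last first.
  by apply: sumr_ge0 => v _; exact: crush_mass_ge0.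
by rewrite /crush_mass yL fy subr0 (max_l (ltW e0)) ltr_wpDl// le_max lexx orbT.
Qed.

(** Two vertices of the new support are adjacent because both survive from the
    carrier of p, or both belong to L, or one survives and the other receives
    mass, which is the case of [far_lt]. *)
Lemma crush_realization e p : realization_set R (rips [set: X]%SET r) p ->
  0 <= e <= p x -> realization_set R (rips [set: X]%SET r) (crush e p).
Proof.
move=> Kp ex; have S0 := crush_mass_sum_gt0 _ _ Kp ex.
have [p0 _ _ pr] := (rips_realizationP _ _ _ r0).1 Kp.
have supp v : crush e p v != 0 -> e < p v \/ (v \in L /\ far p v < e).
  rewrite mulf_eq0 negb_or => /andP[mv _]; exact: crush_mass_supp.
apply/rips_realizationP => //; split=> //.
- by move=> v; rewrite divr_ge0 ?crush_mass_ge0// ltW.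
- by rewrite -mulr_suml divff// gt_eqF.
- have pos v : e < p v -> p v != 0.
    by case/andP: ex => e0 _ ev; rewrite gt_eqF// (le_lt_trans e0).
  move=> u v /supp[eu|[uL fu]] /supp[ev|[vL fv]].
  + by apply: pr; exact: pos.
  + exact: far_lt fv eu.
  + by rewrite metric_sym; exact: far_lt fu ev.
  + by move/diam_leP: Lr; exact.
Qed.

(** Since x is not in L, it receives nothing back. *)
Lemma crush_full p : crush (p x) p x = 0.
Proof. by rewrite /crush /crush_mass (negbTE xL) subrr maxxx addr0 mul0r. Qed.

Lemma crush_retraction p : realization_set R (rips [set: X]%SET r) p ->
  realization_set R (rips ([set: X] :\ x)%SET r) (crush (p x) p).
Proof.
move=> Kp; apply/rips_realization_D1 => //; split; last exact: crush_full.
by case: (Kp) => p0 _ _; apply: crush_realization; rewrite ?p0 ?lexx.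
Qed.

Lemma continuous_crush (T : topologicalType) (e : T -> R) (p : T -> X -> R) v :
  continuous e -> (forall u, continuous (p^~ u)) ->
  (forall t, \sum_u crush_mass (e t) (p t) u != 0) ->
  continuous (fun t => crush (e t) (p t) v).
Proof.
move=> ec pc S0.
have mc u : continuous (fun t => crush_mass (e t) (p t) u).
  have posc (f g : T -> R) : continuous f -> continuous g ->
      continuous (fun t => Num.max (f t - g t) 0).
    move=> fc gc t; apply: (@continuous_max _ _ (f \- g) (cst 0)).
      by apply: cvgB; [exact: fc|exact: gc].
    exact: cvg_cst.
  have fc : continuous (fun t => far (p t) u).
    by apply: continuous_big => // ab; exact: add_continuous.
  move=> t; apply: cvgD; first exact: (posc _ _ (pc u) ec).
  by case: ifP => _; [exact: (posc _ _ ec fc)|exact: cvg_cst].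
move=> t; apply: cvgM; first exact: mc.
apply: cvgV => //.
by apply: continuous_big => // ab; exact: add_continuous.
Qed.

End crushing.

Lemma homotopic_eqfun (R : realType) (X Y : topologicalType) (f g : X -> Y) :
  continuous f -> f =1 g -> homotopic R f g.
Proof.
move=> fc fg; exists (fun z => f z.1); split=> //.
apply: continuous_subspaceT => z.
by apply: continuous_comp; [exact: cvg_fst|exact: fc].
Qed.

Theorem theorem3p7 (R : realType) (X : finMetricType R) (x : X) (r : R) :
  0 < r ->
  locally_crushable x r ->
  homotopy_equivalent R
    (realization R (rips [set: X]%SET r))
    (realization R (rips ([set: X] :\ x)%SET r)).
Proof.
move=> /ltW r0 [L [xL Lr Lx]].
set K := rips [set: X]%SET r; set K' := rips ([set: X] :\ x)%SET r.
have KP (p : realization R K) : realization_set R K (val p).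
  exact: set_valP.
have K'P (p : realization R K') : realization_set R K (val p) /\ val p x = 0.
  by apply/(rips_realization_D1 _ _ _ r0); exact: set_valP.
pose f (p : realization R K) : realization R K' :=
  exist _ (crush r L (val p x) (val p))
    (mem_set (crush_retraction _ _ _ r0 xL Lr Lx _ (KP p))).
pose g (p : realization R K') : realization R K :=
  exist _ (val p) (mem_set (K'P p).1).
(* The factor 1 - s is clamped to [0, 1], so that the homotopy is defined, and
   even continuous, for all real values of s. *)
pose c (s : R) := Num.max 0 (Num.min (1 - s) 1).
have c01 s : 0 <= c s <= 1.
  by rewrite /c le_max lexx ge_max ler01 ge_min lexx orbT.
have ex (z : realization R K * R) : 0 <= c z.2 * val z.1 x <= val z.1 x.
  have [p0 _ _] := KP z.1; have /andP[s0 s1] := c01 z.2.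
  by apply/andP; split; [exact: mulr_ge0|exact: ler_piMl].
pose H (z : realization R K * R) : realization R K :=
  exist _ (crush r L (c z.2 * val z.1 x) (val z.1))
    (mem_set (crush_realization _ _ _ r0 Lr Lx _ _ (KP z.1) (ex z))).
have cc : continuous c.
  apply: max_fun_continuous; first by move=> s; exact: cvg_cst.
  apply: min_fun_continuous; last by move=> s; exact: cvg_cst.
  by move=> s; apply: cvgB; [exact: cvg_cst|exact: cvg_id].
have Hc : continuous H.
  apply: continuous_to_realization => v; apply: continuous_crush.
  - move=> z; apply: cvgM.
      by apply: (@continuous_comp _ _ _ snd c); [exact: cvg_snd|exact: cc].
    by apply: (@continuous_comp _ _ _ fst (fun p : realization R K => val p x));
      [exact: cvg_fst|exact: continuous_coord].
  - move=> u z.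
    by apply: (@continuous_comp _ _ _ fst (fun p : realization R K => val p u));
      [exact: cvg_fst|exact: continuous_coord].
  - by move=> z; rewrite gt_eqF// (crush_mass_sum_gt0 x).
have fc : continuous f.
  apply: continuous_to_realization => v; apply: continuous_crush.
  - exact: continuous_coord.
  - by move=> u; exact: continuous_coord.
  - move=> p; rewrite gt_eqF// (crush_mass_sum_gt0 x)// lexx andbT.
    by have [] := KP p.
have gc : continuous g.
  by apply: continuous_to_realization => v; exact: continuous_coord.
exists f, g; split=> //.
  exists H; split; first exact: continuous_subspaceT.
    by move=> p; apply: val_inj; rewrite /= /c subr0 minxx max_r ?ler01// mul1r.
  move=> p; apply: val_inj; rewrite /= /c subrr min_l ?ler01// maxxx mul0r.
  exact/crush0/KP.
apply: homotopic_eqfun => p.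
  by apply: continuous_comp; [exact: gc|exact: fc].
by apply: val_inj; have [Kp px] := K'P p; rewrite /= px crush0.
Qed.
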